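(* For each positive integer $n$, let $A_n$ be the set of all integers $x$ such that there exists a connected graph on $n$ vertices having exactly $x$ spanning trees. Then $$\lim_{n\to\infty}\frac{|A_n|}{\sqrt{n}\,\exp\!\left(2\pi\sqrt{\frac{n}{3\log n}}\right)}=\infty,$$ i.e. $|A_n|=\omega\!\left(\sqrt{n}\,\exp\!\left(2\pi\sqrt{\frac{n}{3\log n}}\right)\right)$.
   Context: Graphs are finite and simple. $f(n)=\omega(g(n))$ means that for every $c>0$ there is $n_0$ with $|f(n)|\ge c|g(n)|$ for all $n>n_0$. $\log$ denotes the natural logarithm. *)

(* Defs.v *)
From HB Require Import structures.
From mathcomp Require Import all_boot all_order all_algebra.
From mathcomp Require Import finmap.
From mathcomp Require Import all_classical all_reals all_analysis.

Set Implicit Arguments.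
Unset Strict Implicit.
Unset Printing Implicit Defensive.

Import Order.TTheory GRing.Theory Num.Theory.
Import numFieldNormedType.Exports.

(* A finite simple graph with vertex type T is given by its edge set, a set
   of 2-element subsets of T. *)
Definition simple_graph (T : finType) (E : {set {set T}}) : bool :=
  [forall e in E, #|e| == 2].

(* Since [set x; x] has one element, no vertex of a simple graph is adjacent
   to itself. *)
Definition adj (T : finType) (E : {set {set T}}) : rel T :=
  fun x y => [set x; y] \in E.

Definition connected_graph (T : finType) (E : {set {set T}}) : bool :=
  [forall x, forall y, connect (adj E) x y].

Definition acyclic_graph (T : finType) (E : {set {set T}}) : Prop :=
  forall c : seq T, 2 < size c -> ~ ucycle (adj E) c.

Definition tree (T : finType) (E : {set {set T}}) : Prop :=
  [/\ simple_graph E, connected_graph E & acyclic_graph E].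

(* A spanning subgraph keeps all the vertices, so it is determined by its
   edge set. *)
Definition spanning_trees (T : finType) (E : {set {set T}}) :
    {set {set {set T}}} :=
  [set F : {set {set T}} | (F \subset E) && `[< tree F >]].

(* Every graph on n vertices is isomorphic to one with vertex set
   {0, ..., n - 1}. *)
Definition spanning_tree_counts (n : nat) : set nat :=
  [set x | exists E : {set {set 'I_n}},
     [/\ simple_graph E, connected_graph E & #|spanning_trees E| = x]]%classic.

(* fset_set is the empty set on infinite arguments, so the cardinal
   #|` fset_set A| is the intended one only for finite A. *)
Lemma finite_spanning_tree_counts (n : nat) :
  finite_set (spanning_tree_counts n).
Proof.
apply: (@sub_finite_set _ _
  ((fun E : {set {set 'I_n}} => #|spanning_trees E|) @` setT)%classic).
  by move=> x [E [_ _ <-]]; exists E.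
exact/finite_image/finite_finset.
Qed.

Definition num_spanning_tree_counts (n : nat) : nat :=
  #|` fset_set (spanning_tree_counts n)|.

Local Open Scope ring_scope.

(* The values at n = 0, 1, where the logarithm or the quotient is degenerate,
   are irrelevant as n tends to infinity. *)
Definition growth (R : realType) (n : nat) : R :=
  Num.sqrt n%:R * expR (2 * pi * Num.sqrt (n%:R / (3 * ln n%:R))).

(* f(n) = omega(g(n)) *)
Definition is_omega (R : realType) (f g : nat -> R) : Prop :=
  forall c : R, 0 < c ->
    exists n0 : nat, forall n : nat, (n0 < n)%N -> c * `|g n| <= `|f n|.

(* Main.v *)
(* Consider a path whose first vertex and some of whose other vertices are
   joined to a hub.  Let T be the number of its spanning trees, and F the
   number of its spanning forests with two components that separate the hub
   from the last vertex of the path.  Appending a vertex to the path turns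
   (T, F) into (T, T + F), or into (2T + F, T + F) if the new vertex is joined
   to the hub.  So m steps of the first kind followed by one of the second kind
   give ((m + 2) T + F, (m + 1) T + F).  This map determines (T, F) and m when
   0 < F <= T, a condition that it preserves; hence at most T of the pairs
   obtained share the first component T, and there are at least as many first
   components as the sum of 1/T over all the pairs.  One step multiplies T by
   at most m + 3, so with m < 5 this sum is at least
   (1/3 + 1/4 + 1/5 + 1/6 + 1/7)^k after k steps, which use at most 5k
   vertices.  As 1/3 + ... + 1/7 > 1, the number of spanning tree counts grows
   exponentially in the number of vertices. *)

Require Import Defs.
From HB Require Import structures.
From mathcomp Require Import all_boot all_order all_algebra.
From mathcomp Require Import finmap.
From mathcomp Require Import all_classical all_reals all_analysis.
From mathcomp Require Import zify ring lra.
Import Order.TTheory GRing.Theory Num.Theory.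
Import numFieldNormedType.Exports.
Local Open Scope classical_set_scope.
Local Open Scope ring_scope.

Set Implicit Arguments.
Unset Strict Implicit.
Unset Printing Implicit Defensive.

(** * Minimally connected graphs *)

Section Graphs.
Local Open Scope nat_scope.
Local Open Scope set_scope.

Lemma connect_homo (T T' : finType) (e : rel T) (e' : rel T') (h : T -> T') :
  (forall x y, e x y -> connect e' (h x) (h y)) ->
  forall x y, connect e x y -> connect e' (h x) (h y).
Proof.
move=> he x y /connectP [p + ->]; elim: p x => [|z p IH] x /=.
  by rewrite connect0.
by case/andP=> /he exz /IH; apply: connect_trans.
Qed.

Lemma adj_sym (T : finType) (E : {set {set T}}) : symmetric (adj E).
Proof. by move=> x y; rewrite /adj finset.setUC. Qed.

Lemma connect_adj_sym (T : finType) (E : {set {set T}}) :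
  connect_sym (adj E).
Proof. exact: (sym_connect_sym (@adj_sym T E)). Qed.

Lemma connectedP (T : finType) (E : {set {set T}}) :
  reflect (forall x y, connect (adj E) x y) (connected_graph E).
Proof.
apply: (iffP forallP) => [H x y|H x]; first exact: (forallP (H x)).
exact/forallP.
Qed.

(* Unlike acyclicity, minimality only refers to connectedness, which is easy
   to follow through the addition of a vertex. *)
Definition min_connected (T : finType) (E : {set {set T}}) : bool :=
  [&& simple_graph E, connected_graph E
    & [forall e in E, ~~ connected_graph (E :\ e)]].

(** An edge on a cycle can be deleted without disconnecting the graph. Conversely, if deleting an
    edge leaves its ends connected, a simple path between them closes up to a cycle with that
    edge. *)
Lemma min_connectedP (T : finType) (E : {set {set T}}) :
  reflect (tree E) (min_connected E).
Proof.
apply: (iffP and3P) => -[simE conE].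
  move=> /forall_inP minE; split=> // -[//|x [//|y [//|z r]]] _.
  case/andP=> /= /and3P [exy eyz ezx].
  rewrite !inE !negb_or => /and3P [/and3P [xy xz xr] /andP [yz yr] _].
  have /negP := minE _ exy; apply; apply/connectedP => a b.
  have cyx : connect (adj (E :\ [set x; y])) y x.
    apply: (@connect_trans _ _ z).
      apply/connect1; rewrite /adj !inE (eyz : _ \in E) andbT.
      apply/eqP => /setP /(_ x); rewrite !inE eqxx (negPf xy) (negPf xz).
      by [].
    apply/connectP; exists (rcons r x); last by rewrite last_rcons.
    (* Off its start, the arc from [z] back to [x] never meets [y], so it does not use the edge
       [[set x; y]]. *)
    have ya : all (predC1 y) (z :: rcons r x).
      rewrite /= all_rcons /= eq_sym yz xy /=.
      by apply/allP => u ur; apply: contraNneq yr => <-.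
    apply: (sub_in_path (P := predC1 y)) ya ezx => u w /= uy wy.
    rewrite /adj !inE => ->; rewrite andbT.
    apply/eqP => /setP /(_ y); rewrite !inE eqxx orbT.
    by rewrite ![y == _]eq_sym (negPf uy) (negPf wy).
  have := connectedP _ conE a b; apply: (connect_homo (h := id)) => u w uw.
  have [euw|ne] := eqVneq [set u; w] [set x; y]; last first.
    by apply: connect1; rewrite /adj !inE ne.
  have : u \in [set x; y] by rewrite -euw !inE eqxx.
  have : w \in [set x; y] by rewrite -euw !inE eqxx orbT.
  rewrite !inE => /orP[] /eqP -> /orP[] /eqP -> //; rewrite ?connect0 //.
  by rewrite connect_adj_sym.
move=> acE; split=> //; apply/forall_inP => e eE; apply/negP => /connectedP con.
have /eqP/eqP/cards2P [x [y [xy exy]]] := forall_inP simE _ eE.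
have /connectP [p pth] := con x y.
case/shortenP: pth => {}p pth unp _ lst.
apply: (acE (x :: p)).
  (* A path with one vertex would give [x = y]; one with two vertices would be the deleted edge [e]
     itself. *)
  case: p pth unp lst => [|z [|w p]] //=.
    by move=> _ _ yx; rewrite yx eqxx in xy.
  move=> + _ yz; rewrite andbT -yz /adj -exy !inE eqxx //.
rewrite /ucycle unp andbT /= rcons_path -lst; apply/andP; split; last first.
  by rewrite /adj finset.setUC -exy.
by apply: sub_path pth => u w; rewrite /adj inE => /andP [].
Qed.

Lemma spanning_treesE (T : finType) (E : {set {set T}}) :
  #|spanning_trees E| =
  #|[set F : {set {set T}} | (F \subset E) & min_connected F]|.
Proof.
apply: eq_card => F; rewrite !inE; congr (_ && _).
by apply/asboolP/idP => /min_connectedP.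
Qed.

(** * Counting subsets *)

Definition count_subsets (X : finType) (G : {set X}) (P : pred {set X}) : nat :=
  #|[set F : {set X} | (F \subset G) && P F]|.

Lemma eq_count_subsets (X : finType) (G : {set X}) (P Q : pred {set X}) :
  (forall F : {set X}, F \subset G -> P F = Q F) ->
  count_subsets G P = count_subsets G Q.
Proof.
by move=> PQ; apply: eq_card => F; rewrite !inE; apply: andb_id2l => /PQ.
Qed.

Lemma count_subsets_pred0 (X : finType) (G : {set X}) (P : pred {set X}) :
  (forall F : {set X}, F \subset G -> P F = false) -> count_subsets G P = 0.
Proof.
move=> P0; apply/eqP; rewrite cards_eq0; apply/eqP/setP => F; rewrite !inE.
by apply/andP => -[/P0 ->].
Qed.

(** Split on whether the subset contains [e]; those that do correspond to subsets of [G] by removing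
    [e]. *)
Lemma count_subsetsU1 (X : finType) (G : {set X}) (P : pred {set X}) e :
  e \notin G ->
  count_subsets (e |: G) P =
  count_subsets G P + count_subsets G (fun F => P (e |: F)).
Proof.
move=> eG; rewrite addnC.
rewrite /count_subsets -(cardsID [set F : {set X} | e \in F]); congr (_ + _).
  rewrite -[RHS](card_in_imset (f := fun F => e |: F)); last first.
    move=> A B; rewrite !inE => /andP [AG _] /andP [BG _].
    move=> /(congr1 (fun F => F :\ e)).
    rewrite !setU1K // ?(contra (fintype.subsetP AG e)) //.
    by rewrite (contra (fintype.subsetP BG e)).
  apply: eq_card => F; rewrite !inE; apply/andP/imsetP => [[/andP [FG PF] eF]|].
    exists (F :\ e); last by rewrite finset.setD1K.
    by rewrite inE finset.setD1K // PF andbT subDset.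
  case=> A; rewrite inE => /andP [AG PA] ->.
  by rewrite PA andbT setU11 finset.setUS.
apply: eq_card => F; rewrite !inE; case: (P F); rewrite ?andbF ?andbT //.
apply/andP/idP => [[eF FG]|FG].
  apply/fintype.subsetP => x xF; have := fintype.subsetP FG _ xF.
  by rewrite in_setU1 => /predU1P [xe|//]; rewrite -xe xF in eF.
split; first exact: contra (fintype.subsetP FG e) eG.
exact: fintype.subset_trans FG (finset.subsetUr _ _).
Qed.

Lemma count_subsets_imset (X Y : finType) (g : X -> Y) (G : {set X})
    (P : pred {set Y}) : injective g ->
  count_subsets (g @: G) P = count_subsets G (fun F => P (g @: F)).
Proof.
move=> ginj; rewrite /count_subsets -(card_imset _ (imset_inj ginj)).
apply: eq_card => F; rewrite !inE; apply/andP/imsetP => [[FG PF]|].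
  have FE : g @: (g @^-1: F) = F.
    apply/setP => y; apply/imsetP/idP => [[x + ->]|yF]; first by rewrite inE.
    have /imsetP [x _ yx] := fintype.subsetP FG _ yF.
    by exists x; rewrite // inE -yx.
  exists (g @^-1: F); rewrite ?inE FE // PF andbT.
  apply/fintype.subsetP => x; rewrite inE => /(fintype.subsetP FG).
  by rewrite mem_imset.
by case=> A; rewrite inE => /andP [AG PA] ->; split; first exact: imsetS.
Qed.

(** * Adding a vertex *)

Section Extension.

Lemma set2_eq (T : finType) (a b c d : T) : [set a; b] = [set c; d] ->
  (a = c /\ b = d) \/ (a = d /\ b = c).
Proof.
move=> abcd.
have : a \in [set c; d] by rewrite -abcd set21.
have : b \in [set c; d] by rewrite -abcd set22.
have : c \in [set a; b] by rewrite abcd set21.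
have : d \in [set a; b] by rewrite abcd set22.
by rewrite !inE => /pred2P [] ? /pred2P [] ? /pred2P [] ? /pred2P [] ?;
  subst; auto.
Qed.

Lemma forall_in_setU1 (X : finType) (e : X) (G : {set X}) (P : pred X) :
  [forall x in e |: G, P x] = P e && [forall x in G, P x].
Proof.
apply/forall_inP/andP => [PG|[Pe /forall_inP PG] x].
  split; first by apply: PG; rewrite setU11.
  by apply/forall_inP => x xG; apply: PG; rewrite inE xG orbT.
by rewrite in_setU1 => /predU1P [->|/PG].
Qed.

Lemma forall_in_imset (X Y : finType) (g : X -> Y) (G : {set X}) (P : pred Y) :
  [forall y in g @: G, P y] = [forall x in G, P (g x)].
Proof.
apply/forall_inP/forall_inP => [PG x xG|PG _ /imsetP [x xG ->]]; last exact: PG.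
by apply: PG; apply: imset_f.
Qed.

Lemma connected_fromP (T : finType) (E : {set {set T}}) (r : T) :
  reflect (forall x, connect (adj E) r x) (connected_graph E).
Proof.
apply: (iffP (connectedP E)) => con x; first exact: con.
by move=> y; apply: connect_trans (con y); rewrite connect_adj_sym.
Qed.

Variable n : nat.
Implicit Types (s t : 'I_n.+1) (E : {set {set 'I_n.+1}}).

Local Notation up := (lift (@ord_max n.+1)).
Local Notation v := (@ord_max n.+1).

(** The old vertices are embedded by [up], which keeps their numbers, and [v] is the new, last
    vertex. *)
Definition shift_edge (e : {set 'I_n.+1}) : {set 'I_n.+2} := up @: e.
Definition shift E : {set {set 'I_n.+2}} := shift_edge @: E.
Definition spoke t : {set 'I_n.+2} := [set up t; v].

Lemma shift_edge_inj : injective shift_edge.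
Proof. exact/imset_inj/lift_inj. Qed.

Lemma shift_edge2 s t : shift_edge [set s; t] = [set up s; up t].
Proof. by rewrite /shift_edge imsetU !imset_set1. Qed.

Lemma card_shift_edge e : #|shift_edge e| = #|e|.
Proof. exact/card_imset/lift_inj. Qed.

Lemma spokeNshift t e : (spoke t == shift_edge e) = false.
Proof.
apply/eqP => /setP /(_ v); rewrite set22 => /esym /imsetP [x _ /eqP].
by rewrite (negPf (neq_lift _ _)).
Qed.

Lemma spoke_notin t E : spoke t \notin shift E.
Proof. by apply/imsetP => -[e _ /eqP]; rewrite spokeNshift. Qed.

Lemma spoke_inj : injective spoke.
Proof.
move=> s t /set2_eq [[/lift_inj]|[/eqP]] //.
by rewrite eq_sym (negPf (neq_lift _ _)).
Qed.

Lemma card_spoke t : #|spoke t| = 2.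
Proof. by rewrite cards2 eq_sym neq_lift. Qed.

Lemma adj_shiftP E a b :
  adj (shift E) a b -> exists x y, [/\ a = up x, b = up y & adj E x y].
Proof.
case/imsetP => e eE abe.
have /imsetP [x _ ax] : a \in up @: e by rewrite -[up @: e]abe set21.
have /imsetP [y _ bys] : b \in up @: e by rewrite -[up @: e]abe set22.
exists x, y; split=> //; rewrite /adj.
suff -> : [set x; y] = e by [].
by apply: shift_edge_inj; rewrite shift_edge2 -ax -bys.
Qed.

Lemma adj_shift E x y : adj E x y -> adj (shift E) (up x) (up y).
Proof. by move=> xy; rewrite /adj -shift_edge2 imset_f. Qed.

(** Collapses the new vertex onto [t], which turns walks of the extended graph into walks of the old
    one. *)
Definition retract t (a : 'I_n.+2) : 'I_n.+1 := odflt t (unlift v a).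

Lemma retract_up t x : retract t (up x) = x.
Proof. by rewrite /retract liftK. Qed.

Lemma retract_max t : retract t v = t.
Proof. by rewrite /retract unlift_none. Qed.

Lemma connect_subU1 (T : finType) (e : {set T}) (G : {set {set T}}) x y :
  adj G x y -> connect (adj (e |: G)) x y.
Proof.
by move=> xy; apply/connect1; rewrite /adj in_setU1 [_ \in G]xy orbT.
Qed.

Lemma connected_shift E : connected_graph (shift E) = false.
Proof.
apply/connectedP => /(_ v (up ord0)) /connectP [[|a p]] /=.
  by move=> _ /eqP; rewrite eq_sym (negPf (neq_lift _ _)).
by case/andP => /adj_shiftP [x [y [/eqP]]]; rewrite (negPf (neq_lift _ _)).
Qed.

Lemma connected_leaf E t :
  connected_graph (spoke t |: shift E) = connected_graph E.
Proof.
apply/(connected_fromP _ (up t))/(connected_fromP _ t) => con.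
  move=> x; have := con (up x).
  move=> /(connect_homo (h := retract t) (e' := adj E)); rewrite !retract_up.
  apply=> a b; rewrite {1}/adj in_setU1 => /predU1P [/set2_eq|/adj_shiftP].
    by case=> -[-> ->]; rewrite retract_up retract_max connect0.
  by case=> y [z [-> -> yz]]; rewrite !retract_up connect1.
move=> a; case: (unliftP v a) => [x ->|->]; last first.
  by apply/connect1; rewrite /adj setU11.
have := con x; apply: connect_homo => y z /adj_shift yz.
exact: connect_subU1.
Qed.

(** The two spokes form a path from [s] to [t] through [v], which replaces the edge [[set s; t]];
    collapsing [v] onto [t] gives that edge back. *)
Lemma connected_bypass E s t :
  connected_graph (spoke s |: (spoke t |: shift E)) =
  connected_graph ([set s; t] |: E).
Proof.
apply/(connected_fromP _ (up t))/(connected_fromP _ t) => con.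
  move=> x; have := con (up x).
  move=> /(connect_homo (h := retract t) (e' := adj ([set s; t] |: E))).
  rewrite !retract_up; apply=> a b; rewrite {1}/adj in_setU1.
  case/predU1P => [/set2_eq|].
    case=> -[-> ->]; rewrite retract_up retract_max connect1 // /adj inE.
      by rewrite set11.
    by rewrite [[set t; s]]finset.setUC set11.
  rewrite in_setU1 => /predU1P [/set2_eq|/adj_shiftP].
    by case=> -[-> ->]; rewrite retract_up retract_max connect0.
  by case=> y [z [-> -> yz]]; rewrite !retract_up connect_subU1.
have tv : connect (adj (spoke s |: (spoke t |: shift E))) (up t) v.
  by apply/connect1; rewrite /adj !inE eqxx orbT.
have sv : connect (adj (spoke s |: (spoke t |: shift E))) (up s) v.
  by apply/connect1; rewrite /adj !inE eqxx.
move=> a; case: (unliftP v a) => [x ->|-> //].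
have := con x; apply: connect_homo => y z.
rewrite {1}/adj in_setU1 => /predU1P [/set2_eq|yz].
  by case=> -[-> ->]; apply: connect_trans (_ : connect _ v _) => //;
    rewrite connect_adj_sym.
apply/connect_subU1; rewrite /adj in_setU1; apply/orP; right.
exact: adj_shift.
Qed.

Lemma simple_setU1 (T : finType) (e : {set T}) (G : {set {set T}}) :
  simple_graph (e |: G) = (#|e| == 2) && simple_graph G.
Proof. exact: forall_in_setU1. Qed.

Lemma simple_shift E : simple_graph (shift E) = simple_graph E.
Proof.
rewrite /simple_graph forall_in_imset; apply: eq_forallb => e.
by rewrite card_shift_edge.
Qed.

Lemma setU1D1 (X : finType) (a b : X) (G : {set X}) : a != b ->
  (a |: G) :\ b = a |: (G :\ b).
Proof.
move=> ab; apply/setP => x; rewrite !inE; have [->|//] := eqVneq x a.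
by rewrite ab.
Qed.

Lemma shiftD1 E e : shift E :\ shift_edge e = shift (E :\ e).
Proof.
apply/setP => e'; rewrite !inE; apply/andP/imsetP => [[ne /imsetP [x xE xe]]|].
  by exists x; rewrite // !inE xE andbT; apply: contraNneq ne => <-; rewrite xe.
case=> x; rewrite !inE => /andP [ne xE] ->; split; last exact: imset_f.
by rewrite (inj_eq shift_edge_inj).
Qed.

Lemma min_connected_shift E : min_connected (shift E) = false.
Proof. by rewrite /min_connected connected_shift andbF. Qed.

(** The spoke is always essential, since without it [v] is isolated; deleting an old edge commutes
    with attaching the leaf. *)
Lemma min_connected_leaf E t :
  min_connected (spoke t |: shift E) = min_connected E.
Proof.
rewrite /min_connected simple_setU1 simple_shift card_spoke connected_leaf /=.
rewrite forall_in_setU1 setU1K ?spoke_notin // connected_shift /=.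
rewrite forall_in_imset; congr [&& _, _ & _]; apply: eq_forallb => e.
by rewrite setU1D1 ?spokeNshift // shiftD1 connected_leaf.
Qed.

Lemma min_connected_bypass E s t : s != t ->
  min_connected (spoke s |: (spoke t |: shift E)) =
  ([set s; t] \notin E) && min_connected ([set s; t] |: E).
Proof.
move=> st; have st' : spoke t != spoke s by rewrite (inj_eq spoke_inj) eq_sym.
have sN : spoke s \notin spoke t |: shift E.
  by rewrite in_setU1 negb_or spoke_notin eq_sym st'.
rewrite /min_connected !simple_setU1 simple_shift !card_spoke.
rewrite connected_bypass /=.
rewrite !forall_in_setU1 setU1K // connected_leaf.
rewrite (finset.setUCA _ [set spoke t]) setU1K; last first.
  by rewrite in_setU1 negb_or spoke_notin st'.
rewrite connected_leaf cards2 st /=.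
(* If [s] and [t] are already adjacent in [E], one of the two spokes is redundant. *)
case: (boolP (_ \in E)) => /= stE.
  rewrite (finset.setUidPr _) ?finset.sub1set //.
  by apply/negP => /and4P [_ conE /negP].
rewrite setU1K // forall_in_imset.
(* Deleting either spoke leaves [E] with a leaf, so both spokes impose the condition that
   [[set s; t]] imposes: [E] is disconnected. *)
rewrite [X in _ && (_ && X)]andbA andbb.
congr [&& _, _, _ & _]; apply: eq_forallb => e.
apply: implyb_id2l => eE.
rewrite !setU1D1 ?spokeNshift //; last by apply: contraNneq stE => ->.
by rewrite shiftD1 -connected_bypass finset.setUCA.
Qed.

End Extension.

(** * Spanning trees of fans *)

(** The number of spanning trees, by [spanning_treesE]. *)
Definition tau (T : finType) (E : {set {set T}}) : nat :=
  count_subsets E (@min_connected T).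

(* When s and t are distinct and not adjacent in F, adding the edge st makes
   F a tree iff F is a forest with two components that separate s from t. *)
Definition phi (T : finType) (E : {set {set T}}) (s t : T) : nat :=
  count_subsets E
    (fun F => ([set s; t] \notin F) && min_connected ([set s; t] |: F)).

Lemma count_subsets_shift n (E : {set {set 'I_n.+1}}) P :
  count_subsets (shift E) P = count_subsets E (fun F => P (shift F)).
Proof. exact/count_subsets_imset/shift_edge_inj. Qed.

Lemma tau_shift n (E : {set {set 'I_n.+1}}) : tau (shift E) = 0.
Proof.
rewrite /tau count_subsets_shift; apply: count_subsets_pred0 => F _.
exact: min_connected_shift.
Qed.

Lemma count_subsets_leaf n (E : {set {set 'I_n.+1}}) t :
  count_subsets (shift E) (fun F => min_connected (spoke t |: F)) = tau E.
Proof.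
rewrite count_subsets_shift; apply: eq_count_subsets => F _.
exact: min_connected_leaf.
Qed.

Lemma count_subsets_bypass n (E : {set {set 'I_n.+1}}) s t : s != t ->
  count_subsets (shift E) (fun F => min_connected (spoke s |: (spoke t |: F)))
  = phi E s t.
Proof.
move=> st; rewrite count_subsets_shift; apply: eq_count_subsets => F _.
exact: min_connected_bypass.
Qed.

Lemma tau_leaf n (E : {set {set 'I_n.+1}}) t :
  tau (spoke t |: shift E) = tau E.
Proof.
rewrite {1}/tau count_subsetsU1 ?spoke_notin // -/(tau (shift E)) tau_shift.
exact: count_subsets_leaf.
Qed.

Lemma spoke_notinU1 n (E : {set {set 'I_n.+1}}) s t : s != t ->
  spoke s \notin spoke t |: shift E.
Proof.
move=> st; rewrite in_setU1 negb_or spoke_notin andbT.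
by rewrite (inj_eq (@spoke_inj n)).
Qed.

(** Trees with exactly one of the two spokes are counted by [tau E] for either spoke, and those with
    both by [phi E s t]. *)
Lemma tau_bypass n (E : {set {set 'I_n.+1}}) s t : s != t ->
  tau (spoke s |: (spoke t |: shift E)) = (tau E).*2 + phi E s t.
Proof.
move=> st; rewrite {1}/tau count_subsetsU1 ?spoke_notinU1 //.
rewrite -/(tau (spoke t |: shift E)) tau_leaf -addnn -addnA; congr (_ + _).
rewrite count_subsetsU1 ?spoke_notin // count_subsets_leaf.
by rewrite count_subsets_bypass.
Qed.

Lemma phi_leaf n (E : {set {set 'I_n.+1}}) s t : s != t ->
  phi (spoke t |: shift E) (lift ord_max s) ord_max = tau E + phi E s t.
Proof.
move=> st; rewrite /phi -/(spoke s).
(* The pair to be joined is [spoke s], which is not an edge here, so the non-membership condition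
   holds automatically. *)
rewrite (eq_count_subsets (Q := fun F => min_connected (spoke s |: F)));
  last first.
  move=> F FE; suff -> : spoke s \notin F by [].
  exact: contra (fintype.subsetP FE (spoke s)) (spoke_notinU1 E st).
rewrite count_subsetsU1 ?spoke_notin // count_subsets_leaf.
by rewrite count_subsets_bypass.
Qed.

(** A set containing [spoke s] is excluded by [phi], so this edge does not change the count of
    [phi_leaf]. *)
Lemma phi_bypass n (E : {set {set 'I_n.+1}}) s t : s != t ->
  phi (spoke s |: (spoke t |: shift E)) (lift ord_max s) ord_max =
  tau E + phi E s t.
Proof.
move=> st; rewrite -phi_leaf // /phi -/(spoke s).
rewrite count_subsetsU1 ?spoke_notinU1 //.
rewrite [X in _ + X]count_subsets_pred0 ?addn0 // => F _.
by rewrite setU11.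
Qed.

(* The hub is ord0 and the path ends at ord_max. *)
Definition reachable (n : nat) (p : nat * nat) : Prop :=
  exists E : {set {set 'I_n.+2}},
    [/\ simple_graph E, connected_graph E, tau E = p.1
      & phi E ord0 ord_max = p.2].

(** The graph is a single edge: its only spanning tree is itself, and the empty forest separates its
    ends. *)
Lemma reachable0 : reachable 0 (1, 1).
Proof.
have mc0 : min_connected (finset.set0 : {set {set 'I_1}}).
  apply/and3P; split; try by apply/forall_inP => e; rewrite inE.
  by apply/connectedP => x y; rewrite !ord1 connect0.
have count0 (P : pred {set {set 'I_1}}) :
    P finset.set0 -> count_subsets finset.set0 P = 1.
  move=> P0; apply: etrans (cards1 (finset.set0 : {set {set 'I_1}})).
  apply: eq_card => F; rewrite !inE finset.subset0.
  by have [->|//] := eqVneq F finset.set0.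
exists (spoke ord0 |: shift finset.set0); split.
- by rewrite simple_setU1 card_spoke simple_shift; case/and3P: mc0.
- by rewrite connected_leaf; case/and3P: mc0.
- by rewrite tau_leaf; apply: count0.
rewrite /phi (_ : [set ord0; ord_max] = spoke (ord0 : 'I_1)); last first.
  by congr [set _; _]; apply: val_inj.
rewrite count_subsetsU1 ?spoke_notin // [X in _ + X]count_subsets_pred0 ?addn0.
  rewrite count_subsets_shift; apply: count0.
  by rewrite spoke_notin min_connected_leaf.
by move=> F _; rewrite setU11.
Qed.

Lemma lift_max0 n : lift (@ord_max n.+1) ord0 = ord0.
Proof. exact: val_inj. Qed.

Lemma reachable_leaf n T F : reachable n (T, F) -> reachable n.+1 (T, T + F).
Proof.
case=> E [/= simE conE tE pE]; exists (spoke ord_max |: shift E); split=> /=.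
- by rewrite simple_setU1 card_spoke simple_shift.
- by rewrite connected_leaf.
- by rewrite tau_leaf.
by rewrite -[ord0]lift_max0 phi_leaf // tE pE.
Qed.

Lemma reachable_bypass n T F :
  reachable n (T, F) -> reachable n.+1 (T.*2 + F, T + F).
Proof.
case=> E [/= simE conE tE pE].
exists (spoke ord0 |: (spoke ord_max |: shift E)); split=> /=.
- by rewrite !simple_setU1 !card_spoke simple_shift.
- rewrite connected_bypass; apply/connectedP => x y.
  have := connectedP _ conE x y; apply: (connect_homo (h := id)).
  exact: connect_subU1.
- by rewrite tau_bypass // tE pE.
by rewrite -[X in phi _ X _]lift_max0 phi_bypass // tE pE.
Qed.

Lemma reachable_leaves n m T F :
  reachable n (T, F) -> reachable (n + m) (T, m * T + F).
Proof.
elim: m => [|m IH] /=; first by rewrite addn0.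
by move=> /IH /reachable_leaf; rewrite addnS addnA mulSn.
Qed.

Lemma reachable_count n T F :
  reachable n (T, F) -> spanning_tree_counts n.+2 T.
Proof.
by case=> E [simE conE /= tE _]; exists E; split=> //; rewrite spanning_treesE.
Qed.

End Graphs.

(** * Lower bound *)

(** The effect of [m] steps [reachable_leaf] followed by one step [reachable_bypass]. *)
Definition block (p : nat * nat) (m : nat) : nat * nat :=
  (m.+2 * p.1 + p.2, m.+1 * p.1 + p.2)%N.

Fixpoint states (k : nat) : seq (nat * nat) :=
  if k is k'.+1 then [seq block p m | p <- states k', m <- iota 0 5]
  else [:: (1, 1)%N].

Lemma mem_statesS k p : p \in states k.+1 ->
  exists q m, [/\ q \in states k, (m < 5)%N & p = block q m].
Proof.
by move/allpairsP => [[q m] [qS]]; rewrite mem_iota => m5 ->; exists q, m.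
Qed.

Lemma states_bounds k p : p \in states k -> (0 < p.2 <= p.1)%N.
Proof.
elim: k p => [|k IH] p; first by rewrite inE => /eqP ->.
by move=> /mem_statesS [[T F] [m [/IH + _ ->]]]; rewrite /block /= !mulSn; lia.
Qed.

(** The difference of the components is [T]; then [m] and [F] come from division by [T], with
    remainder [F] taken between [1] and [T]. *)
Lemma block_inj p q l m : (0 < p.2 <= p.1)%N -> (0 < q.2 <= q.1)%N ->
  block p l = block q m -> (p, l) = (q, m).
Proof.
case: p q => [T F] [T' F'] /= bp bq [e1 e2].
have eT : T = T' by lia.
subst T'; have elm : l = m by nia.
by subst m; congr (_, _, _); lia.
Qed.

Lemma uniq_states k : uniq (states k).
Proof.
elim: k => // k IH; apply: allpairs_uniq => //.
move=> [p l] [q m] /allpairsP [[p' l'] [p'S _ [-> ->]]].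
move=> /allpairsP [[q' m'] [q'S _ [-> ->]]].
by apply: block_inj; apply: states_bounds; eassumption.
Qed.

Lemma reachable_states k p : p \in states k ->
  exists2 j, (j <= 5 * k)%N & reachable j p.
Proof.
elim: k p => [|k IH] p.
  by rewrite inE => /eqP ->; exists 0%N => //; exact: reachable0.
move=> /mem_statesS [[T F] [m [/IH [j jk rj] m5 ->]]].
(* A block adds [m + 1] vertices, at most 5. *)
exists (j + m).+1; first by lia.
have := reachable_bypass (reachable_leaves m rj).
by rewrite /block /= !mulSn -addnn !addnA.
Qed.

(** Further leaves at the end of the path bring the graph to exactly [n.+2] vertices without
    changing [T]. *)
Lemma states_counts k n p : (5 * k <= n)%N -> p \in states k ->
  spanning_tree_counts n.+2 p.1.
Proof.
case: p => [T F] kn /reachable_states [j jk /(reachable_leaves (n - j))].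
by rewrite subnKC; [exact: reachable_count|lia].
Qed.

Lemma count_states k T : (count (fun p => p.1 == T) (states k) <= T)%N.
Proof.
rewrite -size_filter; set s := seq.filter _ _.
suff: (size s <= size [seq (T, F) | F <- iota 1 T])%N.
  by rewrite size_map size_iota.
apply: uniq_leq_size; first exact/filter_uniq/uniq_states.
move=> [T' F]; rewrite mem_filter /= => /andP [/eqP -> /states_bounds /= TF].
by apply: map_f; rewrite mem_iota; lia.
Qed.

(** The constant is [459 / 420 = 1/3 + 1/4 + 1/5 + 1/6 + 1/7], with one term for each [m < 5]. *)
Lemma sum_states_ge (R : realType) k :
  (459 / 420) ^+ k <= \sum_(p <- states k) (p.1%:R : R)^-1.
Proof.
elim: k => [|k IH]; first by rewrite big_seq1 expr0 invr1.
rewrite big_allpairs_dep exprS /=; apply: (le_trans (ler_wpM2l _ IH)) => //.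
rewrite mulr_sumr !big_seq; apply: ler_sum => -[T F] /states_bounds /= TF.
have step m : ((m.+3)%:R^-1 * T%:R^-1 : R) <= (m.+2 * T + F)%:R^-1.
  rewrite -invfM -natrM lef_pV2 ?posrE ?ltr0n ?ler_nat.
  - by rewrite !mulSn; lia.
  - by rewrite muln_gt0 /=; lia.
  - by rewrite !mulSn; lia.
rewrite !big_cons big_nil addr0 (_ : 459 / 420 / T%:R = 3^-1 / T%:R +
  (4^-1 / T%:R + (5^-1 / T%:R + (6^-1 / T%:R + 7^-1 / T%:R)))).
  by rewrite !lerD // step.
by move: (T%:R^-1) => u; lra.
Qed.

Lemma num_counts_ge (R : realType) k n : (5 * k <= n)%N ->
  (459 / 420) ^+ k <= (num_spanning_tree_counts n.+2)%:R :> R.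
Proof.
move=> kn; apply: (le_trans (sum_states_ge R k)).
rewrite /num_spanning_tree_counts; set A := fset_set _.
(* The sum is regrouped by the value [T] of the first component; by [count_states] each [T] then
   contributes at most 1. *)
have -> : \sum_(p <- states k) (p.1%:R : R)^-1 =
    \sum_(p <- states k) \sum_(T <- A) (if p.1 == T then T%:R^-1 else 0).
  apply: eq_big_seq => p pS.
  have pA : p.1 \in A.
    rewrite in_fset_set; last exact: finite_spanning_tree_counts.
    by rewrite inE; apply: states_counts pS.
  rewrite (bigD1_seq p.1) ?fset_uniq //= eqxx big1 ?addr0 // => T.
  by rewrite eq_sym => /negPf ->.
rewrite exchange_big /= -sum1_size natr_sum; apply: ler_sum => T _.
rewrite -big_mkcond big_const_seq iter_addr addr0 -[leLHS]mulr_natr.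
(* The inverse of 0 is 0, so [T = 0] contributes nothing. *)
case: T => [|T]; first by rewrite invr0 mul0r.
by rewrite mulrC ler_pdivrMr // mul1r ler_nat count_states.
Qed.

(** * Comparison of the exponential bound with [growth] *)

Lemma growth_gt0 (R : realType) (n : nat) : (0 < n)%N -> 0 < growth R n.
Proof. by move=> n0; rewrite mulr_gt0 ?expR_gt0 // sqrtr_gt0 ltr0n. Qed.

(** The inequality [ln (1 + y) <= y] at [y = 1/n - 1] gives [ln n >= 1 - 1/n >= 1/2]. *)
Lemma third_le_ln (R : realType) (n : nat) :
  (1 < n)%N -> 1 <= 3 * ln (n%:R : R).
Proof.
move=> n1; have n0 : 0 < n%:R :> R by rewrite ltr0n; lia.
have n2 : (n%:R : R)^-1 <= 2^-1 by rewrite lef_pV2 ?posrE // ler_nat.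
have ni : 0 < (n%:R : R)^-1 by rewrite invr_gt0.
have := @le_ln1Dx R (n%:R^-1 - 1).
rewrite [1 + _]addrC subrK lnV ?posrE // => H.
have {}H := H ltac:(lra).
move: (ln _) H => l; lra.
Qed.

(** A crude bound suffices: the factor [sqrt n] is at most [exp (sqrt n)], and the exponent is at
    most [8 * sqrt n] because [2 * pi <= 8] and [3 * ln n >= 1]. *)
Lemma growth_le (R : realType) (n : nat) : (1 < n)%N ->
  growth R n <= expR (9 * Num.sqrt n%:R).
Proof.
move=> n1; have l1 := third_le_ln R n1.
have s0 := sqrtr_ge0 (n%:R : R).
rewrite (_ : 9 * _ = Num.sqrt n%:R + 8 * Num.sqrt n%:R); last by lra.
rewrite expRD /growth ler_pM ?expR_ge0 //.
  by apply: le_trans (expR_ge1Dx _); lra.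
rewrite ler_expR.
have : Num.sqrt (n%:R / (3 * ln n%:R)) <= Num.sqrt (n%:R : R).
  rewrite ler_sqrt // ler_pdivrMr; last by lra.
  by rewrite ler_peMr // ler0n.
have : 2 * pi <= 8 :> R by have := pihalf_lt2 R; lra.
have := pi_ge0 R; have := sqrtr_ge0 (n%:R / (3 * ln n%:R) : R).
move: (Num.sqrt _) s0 (Num.sqrt _) (pi) => x x0 y p y0 p0 p8 yx.
by apply: ler_pM; lra.
Qed.

Lemma num_counts_omega (R : realType) (c : R) : 0 < c ->
  exists n0 : nat, forall n : nat, (n0 < n)%N ->
    c * growth R n <= (num_spanning_tree_counts n)%:R.
Proof.
move=> c0; pose a : R := 459 / 420.
have a1 : 1 < a by rewrite /a; lra.
have a0 : 0 < a by lra.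
have L0 : 0 < ln a by rewrite ln_gt0.
(* Chosen so that [x >= M] implies [x ^+ 2 * ln a >= 5 * x * (9 + |ln c| + 2 * ln a)]; the term
   [2 * ln a] absorbs the rounding in [n %/ 5]. *)
pose M := (9 + `|ln c| + 2 * ln a) * 5 / ln a.
have M10 : 10 <= M.
  rewrite /M ler_pdivlMr //; have := normr_ge0 (ln c); lra.
exists (maxn 2 (Num.bound (M ^+ 2))) => -[|[|n]];
  rewrite ?gtn_max //= => /andP [_ nM].
have {}nM : M ^+ 2 <= n.+2%:R.
  apply: (le_trans (ltW (archi_boundP (sqr_ge0 M)))).
  by rewrite ler_nat ltnW.
pose x : R := Num.sqrt n.+2%:R.
have xM : M <= x by rewrite -[M]ger0_norm -?sqrtr_sqr ?ler_sqrt ?ler0n; lra.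
have xx : x ^+ 2 = n.+2%:R by rewrite sqr_sqrtr.
apply: le_trans (num_counts_ge R (k := n %/ 5) (n := n) _); last by lia.
rewrite -/a; apply: (le_trans (ler_wpM2l (ltW c0) (@growth_le R n.+2 _))) => //.
(* After taking logarithms the goal is [ln c + 9 * x <= (n %/ 5) * ln a], linear against quadratic
   in [x]. *)
rewrite -/x -{1}[c]lnK ?posrE // -[a in leRHS]lnK ?posrE //.
rewrite -expRM_natl -expRD ler_expR.
have xL : x * (9 + `|ln c| + 2 * ln a) * 5 <= x ^+ 2 * ln a.
  have : x * M * ln a <= x * x * ln a.
    by rewrite !ler_wpM2r // ?ler_wpM2l //; lra.
  rewrite /M; move=> H; apply: le_trans H; rewrite le_eqVlt; apply/orP; left.
  by apply/eqP; field; rewrite gt_eqF.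
have kn : n.+2%:R <= 5 * (n %/ 5)%:R + 6 :> R.
  rewrite -natrM -natrD ler_nat; lia.
have kL : x ^+ 2 * ln a <= (5 * (n %/ 5)%:R + 6) * ln a.
  by rewrite ler_wpM2r ?xx // ltW.
have := ler_norm (ln c).
have : `|ln c| <= x * `|ln c| by rewrite ler_peMl //; lra.
have : ln a <= x * ln a by rewrite ler_peMl //; lra.
rewrite mulr_natl; nra.
Qed.

Theorem theorem1 (R : realType) :
  ((num_spanning_tree_counts n)%:R / growth R n @[n --> \oo] --> +oo) /\
  is_omega (fun n => (num_spanning_tree_counts n)%:R) (growth R).
Proof.
split.
  (* [A] may be negative, so the positive constant [|A| + 1 >= A] is used instead. *)
  apply/cvgryPge => A; have c0 : 0 < `|A| + 1 by rewrite ltr_wpDl.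
  have [n0 n0P] := num_counts_omega c0.
  exists n0.+1 => // n /= n0n.
  have n_gt0 : (0 < n)%N by exact: leq_ltn_trans n0n.
  rewrite ler_pdivlMr ?growth_gt0 //; apply: le_trans (n0P _ n0n).
  apply: ler_wpM2r; first exact/ltW/growth_gt0.
  by apply: (le_trans (ler_norm A)); rewrite lerDl.
move=> c c0; have [n0 n0P] := num_counts_omega c0; exists n0 => n n0n.
by rewrite normr_nat gtr0_norm ?n0P // growth_gt0 // (leq_ltn_trans _ n0n).
Qed.
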